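(* Let $T=3$, and let all sets below be sets of points $(x_1,x_2,x_3,y_1,y_2,y_3,u_2,u_3)\in\mathbb{R}^8$. (A) Suppose $\underline{C}\le\overline{V}<\underline{C}+V$, $\overline{C}-\underline{C}-V\ge0$ and $\overline{C}-\overline{V}-V<0$. (A1) If $L=\ell=2$, then $\mathrm{conv}(P)$ is the set of points satisfying \begin{align*} & u_2+u_3\le y_3,\quad y_1+u_2+u_3\le 1,\quad u_2\ge y_2-y_1,\quad u_3\ge y_3-y_2,\quad u_2\ge0,\quad u_3\ge 0,\\ & x_1\ge\underline{C}y_1,\quad x_2\ge\underline{C}y_2,\quad x_3\ge\underline{C}y_3,\\ & x_1\le\overline{V}y_1+(\overline{C}-\overline{V})(y_2-u_2),\\ & x_2\le\overline{V}y_2+(\overline{C}-\overline{V})(y_3-u_3-u_2),\\ & x_3\le\overline{C}y_3-(\overline{C}-\overline{V})u_3,\\ & x_2-x_1\le\overline{V}y_2-\underline{C}y_1+(\underline{C}+V-\overline{V})(y_3-u_3-u_2),\\ & x_3-x_2\le(\underline{C}+V)y_3-\underline{C}y_2-(\underline{C}+V-\overline{V})u_3,\\ & x_1-x_2\le\overline{V}y_1-(\overline{V}-V)y_2-(\underline{C}+V-\overline{V})u_2,\\ & x_2-x_3\le\overline{V}y_2-\underline{C}y_3+(\underline{C}+V-\overline{V})(y_3-u_3-u_2),\\ & x_1-x_2+x_3\le\overline{V}y_1-(\overline{V}-V)y_2+\overline{V}y_3+(\overline{C}-\overline{V})(y_3-u_3-u_2). \end{align*} (A2) If $L=\ell=1$,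 then $\mathrm{conv}(P)$ is the set of points satisfying \begin{align*} & u_2\ge y_2-y_1,\quad u_3\ge y_3-y_2,\quad u_2\ge0,\quad u_3\ge 0,\quad x_1\ge\underline{C}y_1,\quad x_2\ge\underline{C}y_2,\quad x_3\ge\underline{C}y_3,\\ & u_2\le y_2,\quad u_3\le y_3,\quad y_1+u_2\le1,\quad y_2+u_3\le 1,\\ & x_1\le\overline{V}y_1+(\overline{C}-\overline{V})(y_2-u_2),\\ & x_2\le\overline{C}y_2-(\overline{C}-\overline{V})u_2,\\ & x_2\le\overline{V}y_2+(\overline{C}-\overline{V})(y_3-u_3),\\ & x_3\le\overline{C}y_3-(\overline{C}-\overline{V})u_3,\\ & x_2-x_1\le\overline{V}y_2-\underline{C}y_1+(\underline{C}+V-\overline{V})(y_3-u_3),\\ & x_2-x_1\le(\underline{C}+V)y_2-\underline{C}y_1-(\underline{C}+V-\overline{V})u_2,\\ & x_3-x_2\le(\underline{C}+V)y_3-\underline{C}y_2-(\underline{C}+V-\overline{V})u_3,\\ & x_1-x_2\le\overline{V}y_1-(\overline{V}-V)y_2-(\underline{C}+V-\overline{V})u_2,\\ & x_2-x_3\le\overline{V}y_2-(\overline{V}-V)y_3-(\underline{C}+V-\overline{V})u_3,\\ & x_2-x_3\le(\underline{C}+V)y_2-\underline{C}y_3-(\underline{C}+V-\overline{V})u_2. \end{align*} (B) Suppose $\underline{C}\le\overline{V}<\underline{C}+V$ and $\overline{C}-\underline{C}-V<0$. (B1) If $L=\ell=2$, then $\mathrm{conv}(P)$ is the set of points satisfying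 \begin{align*} & u_2+u_3\le y_3,\quad y_1+u_2+u_3\le 1,\quad u_2\ge y_2-y_1,\quad u_3\ge y_3-y_2,\quad u_2\ge0,\quad u_3\ge 0,\\ & x_1\ge\underline{C}y_1,\quad x_2\ge\underline{C}y_2,\quad x_3\ge\underline{C}y_3,\\ & x_1\le\overline{V}y_1+(\overline{C}-\overline{V})(y_2-u_2),\quad x_2\le\overline{V}y_2+(\overline{C}-\overline{V})(y_3-u_3-u_2),\quad x_3\le\overline{C}y_3-(\overline{C}-\overline{V})u_3. \end{align*} (B2) If $L=\ell=1$, then $\mathrm{conv}(P)$ is the set of points satisfying \begin{align*} & u_2\ge y_2-y_1,\quad u_3\ge y_3-y_2,\quad u_2\ge0,\quad u_3\ge 0,\quad x_1\ge\underline{C}y_1,\quad x_2\ge\underline{C}y_2,\quad x_3\ge\underline{C}y_3,\\ & u_2\le y_2,\quad u_3\le y_3,\quad y_1+u_2\le1,\quad y_2+u_3\le 1,\\ & x_1\le\overline{V}y_1+(\overline{C}-\overline{V})(y_2-u_2),\quad x_2\le\overline{C}y_2-(\overline{C}-\overline{V})u_2,\\ & x_2\le\overline{V}y_2+(\overline{C}-\overline{V})(y_3-u_3),\quad x_3\le\overline{C}y_3-(\overline{C}-\overline{V})u_3. \end{align*}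
   Context: $T$ is the number of time periods, $L,\ell$ are positive integers (minimum-up and minimum-down time), and $\underline{C},\overline{C},\overline{V},V$ are real parameters (generation lower bound, generation upper bound, start-up/shut-down ramp rate, ramp rate in the stable region) with $0\le\underline{C}\le\overline{V}\le\overline{C}$ and $V>0$. For integers $a,b$, $[a,b]_{\mathbb{Z}}$ is the set of integers $i$ with $a\le i\le b$. $P$ is the set of $(x,y,u)\in\mathbb{R}_+^T\times\{0,1\}^T\times\{0,1\}^{T-1}$, with $x=(x_1,\dots,x_T)$, $y=(y_1,\dots,y_T)$, $u=(u_2,\dots,u_T)$, such that \begin{align*} &\textstyle\sum_{i=t-L+1}^{t}u_i\le y_t,\ t\in[L+1,T]_{\mathbb{Z}};\qquad \sum_{i=t-\ell+1}^{t}u_i\le 1-y_{t-\ell},\ t\in[\ell+1,T]_{\mathbb{Z}};\\ &y_t-y_{t-1}-u_t\le 0,\ t\in[2,T]_{\mathbb{Z}};\qquad \underline{C}y_t\le x_t\le\overline{C}y_t,\ t\in[1,T]_{\mathbb{Z}};\\ &x_t-x_{t-1}\le Vy_{t-1}+\overline{V}(1-y_{t-1}),\ t\in[2,T]_{\mathbb{Z}};\qquad x_{t-1}-x_t\le Vy_t+\overline{V}(1-y_t),\ t\in[2,T]_{\mathbb{Z}}. \end{align*} $\mathrm{conv}(P)$ denotes the convex hull of $P$. *)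

(* Defs.v *)
From mathcomp Require Import all_boot all_order all_algebra.
From mathcomp Require Import boolp classical_sets reals convex.

Set Implicit Arguments.
Unset Strict Implicit.
Unset Printing Implicit Defensive.

Import Order.TTheory GRing.Theory Num.Theory.

Local Open Scope classical_set_scope.
Local Open Scope ring_scope.

(* The triple (x, y, u) of R^T * R^T * R^(T-1); u is stored from position 0,
   so that u_t (2 <= t <= T) sits at position t - 2. *)
Notation schedule R T := ('rV[R]_T * 'rV[R]_T * 'rV[R]_T.-1)%type.

(* Value of v at the 0-based position k; the default 0 is only reached for
   k >= n, which none of the index ranges below allows. *)
Definition entry (R : realType) (n : nat) (v : 'rV[R]_n) (k : nat) : R :=
  if insub k is Some i then v 0 i else 0.

(* Coordinates under their usual indices: x_t and y_t for 1 <= t <= T, and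
   u_t for 2 <= t <= T. *)
Definition xc (R : realType) (T : nat) (p : schedule R T) (t : nat) : R :=
  entry p.1.1 (t - 1).
Definition yc (R : realType) (T : nat) (p : schedule R T) (t : nat) : R :=
  entry p.1.2 (t - 1).
Definition uc (R : realType) (T : nat) (p : schedule R T) (t : nat) : R :=
  entry p.2 (t - 2).

(* Parameters: generation bounds Cl <= Cu, start-up/shut-down ramp rate Vb,
   stable ramp rate V, minimum-up time L, minimum-down time l. The truncated
   subtractions on indices are exact, since L < t and l < t where they occur. *)
Definition P (R : realType) (T L l : nat) (Cl Cu Vb V : R) : set (schedule R T) :=
  [set p | let x := xc p in let y := yc p in let u := uc p in
    (forall t, (1 <= t <= T)%N -> 0 <= x t) /\
    (forall t, (1 <= t <= T)%N -> y t = 0 \/ y t = 1) /\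
    (forall t, (2 <= t <= T)%N -> u t = 0 \/ u t = 1) /\
    (forall t, (L + 1 <= t <= T)%N ->
       \sum_(t - L + 1 <= i < t.+1) u i <= y t) /\
    (forall t, (l + 1 <= t <= T)%N ->
       \sum_(t - l + 1 <= i < t.+1) u i <= 1 - y (t - l)%N) /\
    (forall t, (2 <= t <= T)%N -> y t - y (t - 1)%N - u t <= 0) /\
    (forall t, (1 <= t <= T)%N -> Cl * y t <= x t /\ x t <= Cu * y t) /\
    (forall t, (2 <= t <= T)%N ->
       x t - x (t - 1)%N <= V * y (t - 1)%N + Vb * (1 - y (t - 1)%N)) /\
    (forall t, (2 <= t <= T)%N ->
       x (t - 1)%N - x t <= V * y t + Vb * (1 - y t))].

Arguments P {R} T L l Cl Cu Vb V.

Definition conv_hull (R : realType) (E : lmodType R) (A : set E) : set E :=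
  smallest (fun B : set E => convex_set B) A.

Definition set_of_coords3 (R : realType)
    (S : forall x1 x2 x3 y1 y2 y3 u2 u3 : R, Prop) : set (schedule R 3) :=
  [set p | S (xc p 1) (xc p 2) (xc p 3) (yc p 1) (yc p 2) (yc p 3)
             (uc p 2) (uc p 3)].

(* Main.v *)
Require Import Defs.
From mathcomp Require Import all_boot all_order all_algebra.
From mathcomp Require Import boolp classical_sets reals convex interval_inference.
From mathcomp Require Import ring lra.

(* Split a schedule according to its on/off pattern over the three periods.
   The inequalities on (y, u) say that the patterns can be given nonnegative
   weights of total 1.  With L = l = 2 these weights are unique; with L = l = 1
   there is freedom, and it is best to put as much weight as possible on the
   pattern that stays on throughout, so that 110 or 011 gets weight 0.  It then
   remains to write (x1, x2, x3) as a sum of points of the dispatch polytopes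
   scaled by these weights.  Eliminating the summands one by one, in the manner
   of Fourier and Motzkin, leaves exactly the listed inequalities.  In case (B)
   the ramp limit V may be lowered to Cu - Cl, where case (A) applies and the
   ramp inequalities follow from the bounds. *)

Import Order.TTheory GRing.Theory Num.Theory.
Local Open Scope classical_set_scope.
Local Open Scope ring_scope.

Set Implicit Arguments.
Unset Strict Implicit.

(** * Fourier-Motzkin elimination and the splitting of generation *)

(** One step of Fourier-Motzkin elimination. The witness starts as the minimum of 0 and the elements
    of [hi], and is raised to each element of [lo] in turn. *)
Lemma exists_between (R : realType) (lo hi : seq R) :
  all (fun a => all (fun b => a <= b) hi) lo ->
  exists z, all (fun a => a <= z) lo /\ all (fun b => z <= b) hi.
Proof.
elim: lo => [_|a lo IH /= /andP[/allP ahi /IH[z [/allP loz /allP zhi]]]].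
  elim: hi => [|b hi [z [_ /allP zhi]]]; first by exists 0.
  exists (Num.min b z); split=> //=; rewrite ge_min lexx /=.
  by apply/allP => c /zhi zc; rewrite ge_min zc orbT.
exists (Num.max a z); split=> /=.
  rewrite le_max lexx /=; apply/allP => c /loz cz.
  by rewrite le_max cz orbT.
by apply/allP => b bhi; rewrite ge_max ahi ?zhi.
Qed.

(** Meant for an outer period, 1 or 3: [d] goes to pattern 110 or 011, whose share in period 2 is
    [b], and [X - d] to the patterns in which that period is isolated, of capacity [q]. Filling the
    latter first makes [d] minimal, the maximum of 0 and [X - q]; the hypothesis on [X - v - q] is
    then what the ramp limit asks. *)
Lemma outer_split (R : realType) (p c v q X b : R) :
  p <= v -> v <= c -> c <= p + v -> 0 <= q ->
  0 <= X -> X <= c + q -> 0 <= b -> b <= p -> X - v - q <= b ->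
  exists d, [/\ 0 <= d <= c, d - b <= v, b - d <= v & 0 <= X - d <= q].
Proof.
move=> *; have [Xq|qX] := leP X q.
  by exists 0; split; (try apply/andP; try split); lra.
by exists (X - q); split; (try apply/andP; try split); lra.
Qed.

(** Meant for period 2: [d] goes to 110, [f] to 011 and the rest to 010. The lower bounds [P] and
    [Q] are what the ramp limits demand on behalf of periods 1 and 3. *)
Lemma middle_split (R : realType) (p q r P Q Y : R) :
  0 <= p -> 0 <= q -> 0 <= r -> P <= p -> Q <= q -> 0 <= Y -> Y <= p + q + r ->
  P <= Y -> Q <= Y -> P + Q <= Y ->
  exists d f, [/\ 0 <= d <= p, 0 <= f <= q, P <= d, Q <= f & 0 <= Y - d - f <= r].
Proof.
move=> p0 q0 r0 Pp Qq Y0 Yle PY QY PQY.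
have [|d] := @exists_between _ [:: 0; P; Y - q - r] [:: p; Y; Y - Q].
  by rewrite /= !andbT; repeat (apply/andP; split); lra.
rewrite /= !andbT => -[/and3P[? ? ?] /and3P[? ? ?]].
have [|f] := @exists_between _ [:: 0; Q; Y - d - r] [:: q; Y - d].
  by rewrite /= !andbT; repeat (apply/andP; split); lra.
rewrite /= !andbT => -[/and3P[? ? ?] /andP[? ?]].
by exists d, f; split=> //; apply/andP; split; lra.
Qed.

(* Generation is measured above its minimum.  For a pattern of weight w, the
   numbers p, c and v are (Vb - Cl) w, (Cu - Cl) w and V w, indexed by the periods
   in which the pattern is on; no index stands for 111, which receives (g1, g2, g3).
   The last two groups of conclusions are what outer_split and middle_split need
   to distribute the remaining generation over the other patterns. *)
Lemma stable_part (R : realType)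
    (p1 p2 p3 p12 c12 v12 p23 c23 v23 p c v x1 x2 x3 : R) :
  0 <= p1 -> 0 <= p2 -> 0 <= p3 ->
  0 <= p12 -> p12 <= v12 -> v12 <= c12 -> c12 <= p12 + v12 ->
  0 <= p23 -> p23 <= v23 -> v23 <= c23 -> c23 <= p23 + v23 ->
  0 <= p -> p <= v -> v <= c -> c <= p + v ->
  0 <= x1 -> 0 <= x2 -> 0 <= x3 ->
  x1 <= p1 + c12 + c -> x2 <= p2 + p12 + p23 + c -> x3 <= p3 + c23 + c ->
  x2 - x1 <= p2 + p12 + p23 + v -> x2 - x3 <= p2 + p12 + p23 + v ->
  x3 - x2 <= p3 + v23 + v -> x1 - x2 <= p1 + v12 + v ->
  x1 - x2 + x3 <= p1 + p3 + v12 + v23 + v + c ->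
  exists g1 g2 g3,
    [/\ [/\ 0 <= g1 <= c, 0 <= g2 <= c & 0 <= g3 <= c],
        [/\ g1 - g2 <= v, g2 - g1 <= v, g3 - g2 <= v & g2 - g3 <= v],
        [/\ 0 <= x1 - g1 <= c12 + p1, 0 <= x3 - g3 <= c23 + p3
          & 0 <= x2 - g2 <= p2 + p12 + p23],
        x1 - g1 - v12 - p1 <= x2 - g2 & x3 - g3 - v23 - p3 <= x2 - g2 /\
        (x1 - g1 - v12 - p1) + (x3 - g3 - v23 - p3) <= x2 - g2].
Proof.
move=> P1 P2 P3 a1 a2 a3 a4 b1 b2 b3 b4 c1 c2 c3 c4 X1 X2 X3 h1 h2 h3 h4 h5 h6 h7 h8.
(* The variables are eliminated in the order [g1], [g3], [g2] and hence chosen in reverse. The lists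
   for [g2] hold the bounds left after both eliminations, those for [g3] the bounds left after the
   first, and those for [g1] the constraints themselves. *)
have [|g2] := @exists_between R
 [:: 0; x2 - (p2 + p12 + p23); x1 - c12 - v - p1; x3 - c23 - v - p3;
     x1 - x2 + x3 - v12 - v23 - 2 * v - p1 - p3]
 [:: c; x2; x1 + v; c + v12 + p1 - x1 + x2; x3 + v; c + v23 + p3 - x3 + x2;
     2 * c + v12 + v23 + p1 + p3 - x1 + x2 - x3].
  by rewrite /= !andbT; repeat (apply/andP; split); lra.
rewrite /= !andbT => -[/and5P[? ? ? ? ?] /and5P[? ? ? ? /and3P[? ? ?]]].
clear P2 a4 b4 X2 h2 h4 h5 h8.
have [|g3] := @exists_between R
 [:: 0; g2 - v; x3 - c23 - p3; g2 - x2 + x3 - v23 - p3;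
     g2 + x1 - x2 + x3 - c - v12 - v23 - p1 - p3;
     x1 - x2 + x3 - v12 - v23 - v - p1 - p3]
 [:: c; g2 + v; x3].
  by rewrite /= !andbT; repeat (apply/andP; split); lra.
rewrite /= !andbT => -[/and5P[? ? ? ? /andP[? ?]] /and3P[? ? ?]].
clear P3 b1 b2 b3 h3 c2 c4 X3 h6.
have [|g1] := @exists_between R
 [:: 0; g2 - v; x1 - c12 - p1; g2 + x1 - x2 - v12 - p1;
     g2 - g3 + x1 - x2 + x3 - v12 - v23 - p1 - p3]
 [:: c; g2 + v; x1].
  by rewrite /= !andbT; repeat (apply/andP; split); lra.
rewrite /= !andbT => -[/and5P[? ? ? ? ?] /and3P[? ? ?]].
exists g1, g2, g3; clear P1 a1 a2 a3 c1 c3 X1 h1 h7.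
by split; [split; apply/andP; split|split|split; apply/andP; split| |split]; lra.
Qed.

(** * Weighted points of a convex set *)

(** The slice at height [t] of the cone over [K]. Recording [t *: q] instead of a quotient by [t]
    allows weights that vanish. *)
Definition in_cone (R : realType) (E : lmodType R) (K : set E) (t : R) (z : E) :=
  0 <= t /\ exists2 q, K q & z = t *: q.

Lemma convex_comb (R : realType) (E : lmodType R) (K : set E) (a b : R) x y :
  convex_set K -> K x -> K y -> 0 <= a -> 0 <= b -> a + b = 1 ->
  K (a *: x + b *: y).
Proof.
move=> cK Kx Ky a0 b0 ab1.
have a1 : a <= 1 by lra.
have /set_mem := cK x y (Itv01 a0 a1) (mem_set Kx) (mem_set Ky).
by rewrite (_ : b = 1 - a)//; lra.
Qed.

Lemma in_coneD (R : realType) (E : lmodType R) (K : set E) (s t : R) x y :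
  convex_set K -> in_cone K s x -> in_cone K t y -> in_cone K (s + t) (x + y).
Proof.
move=> cK [s0 [q Kq ->]] [t0 [r Kr ->]]; split; first exact: addr_ge0.
have [st0|st0] := eqVneq (s + t) 0.
  have [-> ->] : s = 0 /\ t = 0 by lra.
  by exists q => //; rewrite addr0 !scale0r addr0.
exists ((s / (s + t)) *: q + (t / (s + t)) *: r).
  apply: convex_comb => //; rewrite ?divr_ge0 ?addr_ge0//.
  by rewrite -mulrDl divff.
by rewrite scalerDr !scalerA ![(s + t) * _]mulrC !divfK.
Qed.

Lemma conv_hull_convex (R : realType) (E : lmodType R) (A : set E) :
  convex_set (conv_hull A).
Proof.
move=> x y t /set_mem xA /set_mem yA; apply/mem_set => B [cB AB].
by apply/set_mem/cB; apply/mem_set; [exact: xA|exact: yA].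
Qed.

(** * Schedules and the constraints of [P] in coordinates *)

Definition pt (R : realType) (x1 x2 x3 y1 y2 y3 u2 u3 : R) : schedule R 3 :=
  (\row_i nth 0 [:: x1; x2; x3] i, \row_i nth 0 [:: y1; y2; y3] i,
   \row_i nth 0 [:: u2; u3] i).

Lemma entry_row (R : realType) n (f : nat -> R) k : (k < n)%N ->
  entry (\row_(i < n) f i) k = f k.
Proof. by move=> kn; rewrite /entry insubT mxE. Qed.

Lemma ptE (R : realType) (x1 x2 x3 y1 y2 y3 u2 u3 : R) :
  let p := pt x1 x2 x3 y1 y2 y3 u2 u3 in
  [/\ [/\ xc p 1 = x1, xc p 2 = x2 & xc p 3 = x3],
      [/\ yc p 1 = y1, yc p 2 = y2 & yc p 3 = y3], uc p 2 = u2 & uc p 3 = u3].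
Proof. by rewrite /xc /yc /uc /=; split; [split|split| |]; rewrite entry_row. Qed.

Lemma pt_coords (R : realType) (p : schedule R 3) :
  p = pt (xc p 1) (xc p 2) (xc p 3) (yc p 1) (yc p 2) (yc p 3) (uc p 2) (uc p 3).
Proof.
case: p => -[x y] u; rewrite /pt /xc /yc /uc /=.
congr (_, _, _); apply/rowP => i; rewrite mxE.
- by case: i => -[|[|[|//]]] i /=; rewrite /entry insubT /=; congr (x 0 _); apply: val_inj.
- by case: i => -[|[|[|//]]] i /=; rewrite /entry insubT /=; congr (y 0 _); apply: val_inj.
- by case: i => -[|[|//]] i /=; rewrite /entry insubT /=; congr (u 0 _); apply: val_inj.
Qed.

Lemma scale_pt (R : realType) (t x1 x2 x3 y1 y2 y3 u2 u3 : R) :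
  t *: pt x1 x2 x3 y1 y2 y3 u2 u3 =
  pt (t * x1) (t * x2) (t * x3) (t * y1) (t * y2) (t * y3) (t * u2) (t * u3).
Proof.
congr (_, _, _); apply/rowP => i; rewrite !mxE.
- by case: i => -[|[|[|//]]].
- by case: i => -[|[|[|//]]].
- by case: i => -[|[|//]].
Qed.

Lemma add_pt (R : realType) (x1 x2 x3 y1 y2 y3 u2 u3 x1' x2' x3' y1' y2' y3' u2' u3' : R) :
  pt x1 x2 x3 y1 y2 y3 u2 u3 + pt x1' x2' x3' y1' y2' y3' u2' u3' =
  pt (x1 + x1') (x2 + x2') (x3 + x3') (y1 + y1') (y2 + y2') (y3 + y3')
     (u2 + u2') (u3 + u3').
Proof.
congr (_, _, _); apply/rowP => i; rewrite !mxE.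
- by case: i => -[|[|[|//]]].
- by case: i => -[|[|[|//]]].
- by case: i => -[|[|//]].
Qed.

(* Homogenized: for t = 1 these are the constraints of P that involve x. *)
Definition dispatch (R : realType) (Cl Cu Vb V t y1 y2 y3 x1 x2 x3 : R) : Prop :=
  ((Cl * y1 <= x1 /\ x1 <= Cu * y1) /\ (Cl * y2 <= x2 /\ x2 <= Cu * y2) /\
   (Cl * y3 <= x3 /\ x3 <= Cu * y3)) /\
  (x2 - x1 <= V * y1 + Vb * (t - y1) /\ x3 - x2 <= V * y2 + Vb * (t - y2)) /\
  (x1 - x2 <= V * y2 + Vb * (t - y2) /\ x2 - x3 <= V * y3 + Vb * (t - y3)).

Definition commitment (R : realType) (y1 y2 y3 u2 u3 : R) : Prop :=
  (y1 = 0 \/ y1 = 1) /\ (y2 = 0 \/ y2 = 1) /\ (y3 = 0 \/ y3 = 1) /\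
  (u2 = 0 \/ u2 = 1) /\ (u3 = 0 \/ u3 = 1) /\
  y2 - y1 - u2 <= 0 /\ y3 - y2 - u3 <= 0.

Lemma all3 (Q : nat -> Prop) :
  (forall t, (1 <= t <= 3)%N -> Q t) <-> Q 1%N /\ Q 2%N /\ Q 3%N.
Proof. by split=> [h|[h1 [h2 h3]] [|[|[|[|t]]]] //]; do ?split; apply: h. Qed.

Lemma all23 (Q : nat -> Prop) :
  (forall t, (2 <= t <= 3)%N -> Q t) <-> Q 2%N /\ Q 3%N.
Proof. by split=> [h|[h2 h3] [|[|[|[|t]]]] //]; do ?split; apply: h. Qed.

Lemma only3 (Q : nat -> Prop) :
  (forall t, (3 <= t <= 3)%N -> Q t) <-> Q 3%N.
Proof. by split=> [h|h3 [|[|[|[|t]]]] //]; apply: h. Qed.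

Lemma P22E (R : realType) (Cl Cu Vb V x1 x2 x3 y1 y2 y3 u2 u3 : R) :
  P 3 2 2 Cl Cu Vb V (pt x1 x2 x3 y1 y2 y3 u2 u3) <->
  (0 <= x1 /\ 0 <= x2 /\ 0 <= x3) /\ commitment y1 y2 y3 u2 u3 /\
  dispatch Cl Cu Vb V 1 y1 y2 y3 x1 x2 x3 /\ u2 + u3 <= y3 /\ u2 + u3 <= 1 - y1.
Proof.
rewrite /P /dispatch /commitment /= !all3 !all23 !only3.
(* With both minimum times equal to 2 the sums occur only for t = 3, where the index runs over 2 and
   3. *)
have S (F : nat -> R) : \sum_(2 <= i < 4) F i = F 2%N + F 3%N.
  by rewrite big_ltn// big_nat1.
rewrite ![(3 - _)%N]/= ![(_ + 1)%N]/= ![(2 - 1)%N]/= !S.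
have [[-> -> ->] [-> -> ->] -> ->] := ptE x1 x2 x3 y1 y2 y3 u2 u3.
by tauto.
Qed.

Lemma P11E (R : realType) (Cl Cu Vb V x1 x2 x3 y1 y2 y3 u2 u3 : R) :
  P 3 1 1 Cl Cu Vb V (pt x1 x2 x3 y1 y2 y3 u2 u3) <->
  (0 <= x1 /\ 0 <= x2 /\ 0 <= x3) /\ commitment y1 y2 y3 u2 u3 /\
  dispatch Cl Cu Vb V 1 y1 y2 y3 x1 x2 x3 /\
  (u2 <= y2 /\ u3 <= y3) /\ u2 <= 1 - y1 /\ u3 <= 1 - y2.
Proof.
rewrite /P /dispatch /commitment /= !all3 !all23.
rewrite ![(3 - _)%N]/= ![(2 - _)%N]/= ![(_ + 1)%N]/= !big_nat1.
have [[-> -> ->] [-> -> ->] -> ->] := ptE x1 x2 x3 y1 y2 y3 u2 u3.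
by tauto.
Qed.

(** * On/off patterns and their weighted dispatches *)

(** The start variables are no extra data: a start in period t means off in t - 1 and on in t. *)
Definition mode (R : realType) (s1 s2 s3 : bool) (t x1 x2 x3 : R) : schedule R 3 :=
  pt x1 x2 x3 (t * s1%:R) (t * s2%:R) (t * s3%:R)
     (t * (~~ s1 && s2)%:R) (t * (~~ s2 && s3)%:R).

(* Patterns of weight 0 need not be feasible, which is how the patterns excluded
   by L = l = 2 are handled. *)
Definition available (R : realType) (Cl Cu Vb V : R) (K : set (schedule R 3))
    (s1 s2 s3 : bool) (t : R) :=
  t = 0 \/ forall z1 z2 z3,
    dispatch Cl Cu Vb V 1 s1%:R s2%:R s3%:R z1 z2 z3 -> K (mode s1 s2 s3 1 z1 z2 z3).

(** The constraints are homogeneous, so for [t > 0] division by [t] gives a dispatch of weight 1.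
    For [t = 0] the generation bounds force every [x] to be 0, and any point [q] of [K] serves. *)
Lemma mode_in_cone (R : realType) (Cl Cu Vb V : R) (K : set (schedule R 3))
    (s1 s2 s3 : bool) (t x1 x2 x3 : R) q :
  K q -> 0 <= t ->
  available Cl Cu Vb V K s1 s2 s3 t ->
  dispatch Cl Cu Vb V t (t * s1%:R) (t * s2%:R) (t * s3%:R) x1 x2 x3 ->
  in_cone K t (mode s1 s2 s3 t x1 x2 x3).
Proof.
move=> Kq t0 adm D; split=> //.
have [t00|tn0] := eqVneq t 0.
  exists q => //; rewrite t00 scale0r /mode !mul0r.
  move: D; rewrite t00 /dispatch !mul0r !mulr0 => -[[[? ?] [[? ?] [? ?]]] _].
  have [-> -> ->] : [/\ x1 = 0, x2 = 0 & x3 = 0] by split; lra.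
  have -> : (0 : schedule R 3) = 0 *: pt 0 0 0 0 0 0 0 0 by rewrite scale0r.
  by rewrite scale_pt !mul0r.
have {}t0 : 0 < t by rewrite lt_neqAle eq_sym tn0.
case: adm => [/eqP|adm]; first by rewrite (negPf tn0).
have [z1 z1E] : exists z, x1 = t * z by exists (x1 / t); rewrite mulrC divfK.
have [z2 z2E] : exists z, x2 = t * z by exists (x2 / t); rewrite mulrC divfK.
have [z3 z3E] : exists z, x3 = t * z by exists (x3 / t); rewrite mulrC divfK.
rewrite {}z1E {}z2E {}z3E in D *.
exists (mode s1 s2 s3 1 z1 z2 z3); last by rewrite /mode scale_pt !mul1r.
apply: adm; move: D.
have E a y : a * (t * y) = t * (a * y) by rewrite mulrCA.
have E' a b y : a * (t * y) + b * (t - t * y) = t * (a * y + b * (1 - y)) by ring.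
by rewrite /dispatch !E' !E -!mulrBr !ler_pM2l.
Qed.

(** * Distributing the generation over the patterns *)

Lemma split_bounds (R : realType) (a b s t z : R) :
  0 <= s -> 0 <= t -> a <= b -> a * (s + t) <= z -> z <= b * (s + t) ->
  exists z', [/\ a * s <= z', z' <= b * s, a * t <= z - z' & z - z' <= b * t].
Proof.
move=> s0 t0 ab az zb.
have as_ : a * s <= b * s by exact: ler_wpM2r.
have at_ : a * t <= b * t by exact: ler_wpM2r.
have [|z'] := @exists_between _ [:: a * s; z - b * t] [:: b * s; z - a * t].
  by rewrite /= !andbT; repeat (apply/andP; split); lra.
rewrite /= !andbT => -[/andP[? ?] /andP[? ?]].
by exists z'; split; lra.
Qed.

(** Pattern 101 is off in period 2, so no ramp limit ties its periods 1 and 3 together. Its capacity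
    [p13] is therefore pooled with [p1] in period 1 and with [p3] in period 3, and the pools are
    divided only at the end. *)
Lemma pieces (R : realType)
    (p1 p2 p3 p13 p12 c12 v12 p23 c23 v23 p c v x1 x2 x3 : R) :
  0 <= p1 -> 0 <= p2 -> 0 <= p3 -> 0 <= p13 ->
  0 <= p12 -> p12 <= v12 -> v12 <= c12 -> c12 <= p12 + v12 ->
  0 <= p23 -> p23 <= v23 -> v23 <= c23 -> c23 <= p23 + v23 ->
  0 <= p -> p <= v -> v <= c -> c <= p + v ->
  0 <= x1 -> 0 <= x2 -> 0 <= x3 ->
  x1 <= p1 + p13 + c12 + c -> x2 <= p2 + p12 + p23 + c ->
  x3 <= p3 + p13 + c23 + c ->
  x2 - x1 <= p2 + p12 + p23 + v -> x2 - x3 <= p2 + p12 + p23 + v ->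
  x3 - x2 <= p3 + p13 + v23 + v -> x1 - x2 <= p1 + p13 + v12 + v ->
  x1 - x2 + x3 <= p1 + p13 + (p3 + p13) + v12 + v23 + v + c ->
  exists a b e h1 h3 d1 d2 f2 f3 g1 g2 g3,
    [/\ [/\ x1 = a + h1 + d1 + g1, x2 = b + d2 + f2 + g2
          & x3 = e + h3 + f3 + g3],
        [/\ 0 <= a <= p1, 0 <= b <= p2, 0 <= e <= p3, 0 <= h1 <= p13
          & 0 <= h3 <= p13],
        [/\ 0 <= d1 <= c12, 0 <= d2 <= p12, d1 - d2 <= v12 & d2 - d1 <= v12],
        [/\ 0 <= f2 <= p23, 0 <= f3 <= c23, f2 - f3 <= v23 & f3 - f2 <= v23] &
        [/\ 0 <= g1 <= c, 0 <= g2 <= c & 0 <= g3 <= c] /\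
        [/\ g1 - g2 <= v, g2 - g1 <= v, g3 - g2 <= v & g2 - g3 <= v]].
Proof.
move=> P1 P2 P3 P13 a1 a2 a3 a4 b1 b2 b3 b4 c1 c2 c3 c4 X1 X2 X3.
move=> h1 h2 h3 h4 h5 h6 h7 h8.
have [g1 [g2 [g3 [gbox gramp [/andP[y1 y2] /andP[y3 y4] /andP[y5 y6]] PY [QY PQY]]]]] :=
  stable_part (addr_ge0 P1 P13) P2 (addr_ge0 P3 P13) a1 a2 a3 a4 b1 b2 b3 b4 c1 c2 c3 c4
    X1 X2 X3 h1 h2 h3 h4 h5 h6 h7 h8.
clear X1 X2 X3 h1 h2 h3 h4 h5 h6 h7 h8 c1 c2 c3 c4.
have Pp : x1 - g1 - v12 - (p1 + p13) <= p12 by move: y2 a4; clear; lra.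
have Qp : x3 - g3 - v23 - (p3 + p13) <= p23 by move: y4 b4; clear; lra.
have y6' : x2 - g2 <= p12 + p23 + p2 by move: y6; clear; lra.
have [d2 [f2 [d2box f2box Pd Qf /andP[bl bu]]]] :=
  middle_split a1 b1 P2 Pp Qp y5 y6' PY QY PQY.
have [d20 d2p] := andP d2box; have [f20 f2p] := andP f2box.
have [d1 [d1box d12 d21 /andP[z1 z2]]] :=
  outer_split a2 a3 a4 (addr_ge0 P1 P13) y1 y2 d20 d2p Pd.
have [f3 [f3box f32 f23 /andP[z3 z4]]] :=
  outer_split b2 b3 b4 (addr_ge0 P3 P13) y3 y4 f20 f2p Qf.
(* The pool of period 1 is divided between 100 and 101; the factors 0 and 1 turn the products in
   [split_bounds] into plain bounds. *)
have [a [A1 A2 A3 A4]] : exists a, [/\ 0 <= a, a <= p1, 0 <= x1 - g1 - d1 - a & x1 - g1 - d1 - a <= p13].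
  have := @split_bounds _ 0 1 p1 p13 (x1 - g1 - d1) P1 P13 ler01.
  by rewrite !mul0r !mul1r; apply.
have [e [E1 E2 E3 E4]] : exists e, [/\ 0 <= e, e <= p3, 0 <= x3 - g3 - f3 - e & x3 - g3 - f3 - e <= p13].
  have := @split_bounds _ 0 1 p3 p13 (x3 - g3 - f3) P3 P13 ler01.
  by rewrite !mul0r !mul1r; apply.
exists a, (x2 - g2 - d2 - f2), e, (x1 - g1 - d1 - a), (x3 - g3 - f3 - e), d1, d2, f2, f3, g1, g2, g3.
split; first by split; ring.
- by split; apply/andP; split.
- by split.
- by split.
- by split.
Qed.

(** * Feasible dispatches of each pattern and their sum *)

(** The start-up and shut-down terms alone suffice: [y1 + y2 <= t] gives [Vb * y2 <= Vb * (t - y1)],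
    which dominates [x2], and likewise for the other three ramps. *)
Lemma dispatch_isolated (R : realType) (Cl Cu Vb V t y1 y2 y3 x1 x2 x3 : R) :
  0 <= Cl -> Cl <= Vb -> Vb <= Cu -> 0 <= V -> 0 <= y1 -> 0 <= y2 -> 0 <= y3 ->
  y1 + y2 <= t -> y2 + y3 <= t ->
  Cl * y1 <= x1 <= Vb * y1 -> Cl * y2 <= x2 <= Vb * y2 -> Cl * y3 <= x3 <= Vb * y3 ->
  dispatch Cl Cu Vb V t y1 y2 y3 x1 x2 x3.
Proof.
move=> Cl0 ClVb VbCu V0 y10 y20 y30 y12 y23.
move=> /andP[? ?] /andP[? ?] /andP[? ?].
have Vb0 := le_trans Cl0 ClVb.
have C y : 0 <= y -> [/\ 0 <= Cl * y, Vb * y <= Cu * y & 0 <= V * y].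
  by move=> y0; split; rewrite ?mulr_ge0// ler_wpM2r.
have [? ? ?] := C _ y10; have [? ? ?] := C _ y20; have [? ? ?] := C _ y30.
have ? : Vb * (y1 + y2) <= Vb * t by rewrite ler_wpM2l.
have ? : Vb * (y2 + y3) <= Vb * t by rewrite ler_wpM2l.
by rewrite /dispatch; do ?split; lra.
Qed.

Lemma scaled_limits (R : realType) (Cl Cu Vb V w : R) :
  0 <= Cl -> Cl <= Vb -> Vb <= Cu -> 0 <= V -> 0 <= w ->
  [/\ 0 <= Cl * w, 0 <= V * w, Cl * w <= Vb * w & Vb * w <= Cu * w].
Proof. by move=> *; rewrite !mulr_ge0 ?ler_wpM2r. Qed.

Lemma dispatch12 (R : realType) (Cl Cu Vb V t d1 d2 : R) :
  0 <= Cl -> Cl <= Vb -> Vb <= Cu -> 0 <= V -> 0 <= t ->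
  0 <= d1 <= (Cu - Cl) * t -> 0 <= d2 <= (Vb - Cl) * t ->
  d1 - d2 <= V * t -> d2 - d1 <= V * t ->
  dispatch Cl Cu Vb V t t t 0 (Cl * t + d1) (Cl * t + d2) 0.
Proof.
move=> Cl0 ClVb VbCu V0 /(scaled_limits Cl0 ClVb VbCu V0)[? ? ? ?] /andP[? ?] /andP[? ?] ? ?.
by rewrite /dispatch !mulr0 subr0 subrr mulr0; do ?split; lra.
Qed.

Lemma dispatch23 (R : realType) (Cl Cu Vb V t f2 f3 : R) :
  0 <= Cl -> Cl <= Vb -> Vb <= Cu -> 0 <= V -> 0 <= t ->
  0 <= f2 <= (Vb - Cl) * t -> 0 <= f3 <= (Cu - Cl) * t ->
  f2 - f3 <= V * t -> f3 - f2 <= V * t ->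
  dispatch Cl Cu Vb V t 0 t t 0 (Cl * t + f2) (Cl * t + f3).
Proof.
move=> Cl0 ClVb VbCu V0 /(scaled_limits Cl0 ClVb VbCu V0)[? ? ? ?] /andP[? ?] /andP[? ?] ? ?.
by rewrite /dispatch !mulr0 subr0 subrr mulr0; do ?split; lra.
Qed.

Lemma dispatch123 (R : realType) (Cl Cu Vb V t g1 g2 g3 : R) :
  0 <= Cl -> Cl <= Vb -> Vb <= Cu -> 0 <= V -> 0 <= t ->
  0 <= g1 <= (Cu - Cl) * t -> 0 <= g2 <= (Cu - Cl) * t -> 0 <= g3 <= (Cu - Cl) * t ->
  g1 - g2 <= V * t -> g2 - g1 <= V * t -> g3 - g2 <= V * t -> g2 - g3 <= V * t ->
  dispatch Cl Cu Vb V t t t t (Cl * t + g1) (Cl * t + g2) (Cl * t + g3).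
Proof.
move=> Cl0 ClVb VbCu V0 /(scaled_limits Cl0 ClVb VbCu V0)[? ? ? ?] /andP[? ?] /andP[? ?] /andP[? ?] ? ? ? ?.
by rewrite /dispatch subrr mulr0; do ?split; lra.
Qed.
(* The indices of a weight are the periods in which its pattern is on; w0 is the
   weight of the pattern that is always off. *)
Lemma modes_cover (R : realType) (Cl Cu Vb V : R) (K : set (schedule R 3))
    w0 w1 w2 w3 w12 w23 w13 w123 x1 x2 x3 :
  0 <= Cl -> Cl <= Vb -> Vb <= Cu -> 0 <= V -> Vb <= Cl + V -> Cl + V <= Cu ->
  Cu <= Vb + V -> convex_set K -> K (pt 0 0 0 0 0 0 0 0) ->
  let av := available Cl Cu Vb V K in
  av false false false w0 -> av true false false w1 -> av false true false w2 ->
  av false false true w3 -> av true true false w12 -> av false true true w23 ->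
  av true false true w13 -> av true true true w123 ->
  0 <= w0 -> 0 <= w1 -> 0 <= w2 -> 0 <= w3 -> 0 <= w12 -> 0 <= w23 -> 0 <= w13 ->
  0 <= w123 -> w0 + w1 + w2 + w3 + w12 + w23 + w13 + w123 = 1 ->
  Cl * (w1 + w12 + w13 + w123) <= x1 -> Cl * (w2 + w12 + w23 + w123) <= x2 ->
  Cl * (w3 + w23 + w13 + w123) <= x3 ->
  x1 <= Vb * (w1 + w13) + Cu * (w12 + w123) ->
  x2 <= Vb * (w2 + w12 + w23) + Cu * w123 ->
  x3 <= Vb * (w3 + w13) + Cu * (w23 + w123) ->
  x2 - x1 <= Vb * (w2 + w12 + w23) + (Cl + V) * w123 - Cl * (w1 + w12 + w13 + w123) ->
  x2 - x3 <= Vb * (w2 + w12 + w23) + (Cl + V) * w123 - Cl * (w3 + w23 + w13 + w123) ->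
  x3 - x2 <= Vb * (w3 + w13) + V * (w23 + w123) - Cl * (w2 + w12) ->
  x1 - x2 <= Vb * (w1 + w13) + V * (w12 + w123) - Cl * (w2 + w23) ->
  x1 - x2 + x3 <=
    Vb * (w1 + w3 + 2 * w13) + V * (w12 + w23 + w123) + Cu * w123 - Cl * w2 ->
  K (pt x1 x2 x3 (w1 + w12 + w13 + w123) (w2 + w12 + w23 + w123)
        (w3 + w23 + w13 + w123) (w2 + w23) (w3 + w13)).
Proof.
move=> Cl0 ClVb VbCu V0 VbV ClCu CuVb cK K0 av A0 A1 A2 A3 A12 A23 A13 A123.
move=> p0 p1 p2 p3 p12 p23 p13 p123 sumw h1 h2 h3 h4 h5 h6 h7 h8 h9 h10 h11.
(* Multiplied by a weight, the chain [Vb <= Cl + V <= Cu <= Vb + V] becomes the chain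
   [p <= v <= c <= p + v] required by [pieces]. *)
have B w : 0 <= w ->
    [/\ 0 <= (Vb - Cl) * w, (Vb - Cl) * w <= V * w, V * w <= (Cu - Cl) * w
      & (Cu - Cl) * w <= (Vb - Cl) * w + V * w].
  by move=> w_ge0; rewrite -mulrDl mulr_ge0 ?ler_wpM2r//; lra.
have [B1 _ _ _] := B _ p1; have [B2 _ _ _] := B _ p2; have [B3 _ _ _] := B _ p3.
have [B13 _ _ _] := B _ p13; have [a1 a2 a3 a4] := B _ p12.
have [b1 b2 b3 b4] := B _ p23; have [c1 c2 c3 c4] := B _ p123.
have := @pieces R ((Vb - Cl) * w1) ((Vb - Cl) * w2) ((Vb - Cl) * w3) ((Vb - Cl) * w13)
  ((Vb - Cl) * w12) ((Cu - Cl) * w12) (V * w12)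
  ((Vb - Cl) * w23) ((Cu - Cl) * w23) (V * w23)
  ((Vb - Cl) * w123) ((Cu - Cl) * w123) (V * w123)
  (x1 - Cl * (w1 + w12 + w13 + w123)) (x2 - Cl * (w2 + w12 + w23 + w123))
  (x3 - Cl * (w3 + w23 + w13 + w123)) B1 B2 B3 B13 a1 a2 a3 a4 b1 b2 b3 b4 c1 c2 c3 c4.
case.
- by rewrite subr_ge0.
- by rewrite subr_ge0.
- by rewrite subr_ge0.
- by move: h4; clear; lra.
- by move: h5; clear; lra.
- by move: h6; clear; lra.
- by move: h7; clear; lra.
- by move: h8; clear; lra.
- by move: h9; clear; lra.
- by move: h10; clear; lra.
- by move: h11; clear; lra.
move=> a [b [e [z1 [z3 [d1 [d2 [f2 [f3 [g1 [g2 [g3 [[X1 X2 X3]]]]]]]]]]]]].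
case=> Ia Ib Ie Iz1 Iz3 [Id1 Id2 d12 d21] [If2 If3 f23 f32].
case=> -[Ig1 Ig2 Ig3] [g12 g21 g32 g23].
clear h1 h2 h3 h4 h5 h6 h7 h8 h9 h10 h11 B1 B2 B3 B13 a1 a2 a3 a4 b1 b2 b3 b4 c1 c2 c3 c4 B.
have shift w z : 0 <= z <= (Vb - Cl) * w -> Cl * w <= Cl * w + z <= Vb * w.
  by case/andP=> ? ?; apply/andP; split; lra.
have isolated (s1 s2 s3 : bool) w y1 y2 y3 : 0 <= w -> ~~ (s1 && s2) -> ~~ (s2 && s3) ->
    Cl * (w * s1%:R) <= y1 <= Vb * (w * s1%:R) ->
    Cl * (w * s2%:R) <= y2 <= Vb * (w * s2%:R) ->
    Cl * (w * s3%:R) <= y3 <= Vb * (w * s3%:R) ->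
    av s1 s2 s3 w -> in_cone K w (mode s1 s2 s3 w y1 y2 y3).
  move=> w_ge0 s12 s23 I1 I2 I3 A; apply: (mode_in_cone K0 w_ge0 A).
  apply: dispatch_isolated => //; rewrite ?mulr_ge0 ?ler0n//.
    by case: s1 s2 s12 {s23 I1 I2 I3 A} => -[]//= _; rewrite ?mulr0 ?mulr1; lra.
  by case: s2 s3 s23 {s12 I1 I2 I3 A} => -[]//= _; rewrite ?mulr0 ?mulr1; lra.
have off w : Cl * (w * 0) <= 0 <= Vb * (w * 0) by rewrite !mulr0 lexx.
have on w z : 0 <= z <= (Vb - Cl) * w -> Cl * (w * 1) <= Cl * w + z <= Vb * (w * 1).
  by rewrite mulr1; exact: shift.
have M0 := @isolated false false false w0 0 0 0 p0 isT isT (off _) (off _) (off _) A0.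
have M1 := @isolated true false false w1 _ 0 0 p1 isT isT (on _ _ Ia) (off _) (off _) A1.
have M2 := @isolated false true false w2 0 _ 0 p2 isT isT (off _) (on _ _ Ib) (off _) A2.
have M3 := @isolated false false true w3 0 0 _ p3 isT isT (off _) (off _) (on _ _ Ie) A3.
have M13 := @isolated true false true w13 _ 0 _ p13 isT isT (on _ _ Iz1) (off _) (on _ _ Iz3) A13.
have M12 : in_cone K w12 (mode true true false w12 (Cl * w12 + d1) (Cl * w12 + d2) 0).
  apply: (mode_in_cone K0 p12 A12); rewrite !mulr1 mulr0.
  by apply: dispatch12.
have M23 : in_cone K w23 (mode false true true w23 0 (Cl * w23 + f2) (Cl * w23 + f3)).
  apply: (mode_in_cone K0 p23 A23); rewrite !mulr1 mulr0.
  by apply: dispatch23.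
have M123 : in_cone K w123 (mode true true true w123 (Cl * w123 + g1) (Cl * w123 + g2) (Cl * w123 + g3)).
  apply: (mode_in_cone K0 p123 A123); rewrite !mulr1.
  by apply: dispatch123.
(* The heights add up to 1, and the slice at height 1 is [K] itself. *)
have := in_coneD cK (in_coneD cK (in_coneD cK (in_coneD cK (in_coneD cK (in_coneD cK (in_coneD cK M0 M1) M2) M3) M12) M23) M13) M123.
rewrite sumw => -[_ [q Kq]]; rewrite scale1r => qE; move: Kq; rewrite -{}qE.
rewrite /mode /= !add_pt !mulr1 !mulr0 !addr0 !add0r.
congr (K (pt _ _ _ _ _ _ _ _)).
all: by clear -X1 X2 X3; lra.
Qed.

(** * The listed inequalities, separated into bounds and ramps *)

Definition bounds22 (R : realType) (Cl Cu Vb x1 x2 x3 y1 y2 y3 u2 u3 : R) : Prop :=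
  u2 + u3 <= y3 /\ y1 + u2 + u3 <= 1 /\
  u2 >= y2 - y1 /\ u3 >= y3 - y2 /\ u2 >= 0 /\ u3 >= 0 /\
  x1 >= Cl * y1 /\ x2 >= Cl * y2 /\ x3 >= Cl * y3 /\
  x1 <= Vb * y1 + (Cu - Vb) * (y2 - u2) /\
  x2 <= Vb * y2 + (Cu - Vb) * (y3 - u3 - u2) /\
  x3 <= Cu * y3 - (Cu - Vb) * u3.

Definition ramps22 (R : realType) (Cl Cu Vb V x1 x2 x3 y1 y2 y3 u2 u3 : R) : Prop :=
  x2 - x1 <= Vb * y2 - Cl * y1 + (Cl + V - Vb) * (y3 - u3 - u2) /\
  x3 - x2 <= (Cl + V) * y3 - Cl * y2 - (Cl + V - Vb) * u3 /\
  x1 - x2 <= Vb * y1 - (Vb - V) * y2 - (Cl + V - Vb) * u2 /\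
  x2 - x3 <= Vb * y2 - Cl * y3 + (Cl + V - Vb) * (y3 - u3 - u2) /\
  x1 - x2 + x3 <= Vb * y1 - (Vb - V) * y2 + Vb * y3
                  + (Cu - Vb) * (y3 - u3 - u2).

Definition bounds11 (R : realType) (Cl Cu Vb x1 x2 x3 y1 y2 y3 u2 u3 : R) : Prop :=
  u2 >= y2 - y1 /\ u3 >= y3 - y2 /\ u2 >= 0 /\ u3 >= 0 /\
  x1 >= Cl * y1 /\ x2 >= Cl * y2 /\ x3 >= Cl * y3 /\
  u2 <= y2 /\ u3 <= y3 /\ y1 + u2 <= 1 /\ y2 + u3 <= 1 /\
  x1 <= Vb * y1 + (Cu - Vb) * (y2 - u2) /\
  x2 <= Cu * y2 - (Cu - Vb) * u2 /\
  x2 <= Vb * y2 + (Cu - Vb) * (y3 - u3) /\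
  x3 <= Cu * y3 - (Cu - Vb) * u3.

Definition ramps11 (R : realType) (Cl Vb V x1 x2 x3 y1 y2 y3 u2 u3 : R) : Prop :=
  x2 - x1 <= Vb * y2 - Cl * y1 + (Cl + V - Vb) * (y3 - u3) /\
  x2 - x1 <= (Cl + V) * y2 - Cl * y1 - (Cl + V - Vb) * u2 /\
  x3 - x2 <= (Cl + V) * y3 - Cl * y2 - (Cl + V - Vb) * u3 /\
  x1 - x2 <= Vb * y1 - (Vb - V) * y2 - (Cl + V - Vb) * u2 /\
  x2 - x3 <= Vb * y2 - (Vb - V) * y3 - (Cl + V - Vb) * u3 /\
  x2 - x3 <= (Cl + V) * y2 - Cl * y3 - (Cl + V - Vb) * u2.

(** At the limit [Cu - Cl] the coefficient [Cl + V - Vb] becomes [Cu - Vb]. Each ramp inequality is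
    then the sum of upper bounds on the generations with a plus sign and lower bounds on those with
    a minus sign. *)
Lemma ramps22_of_bounds (R : realType) (Cl Cu Vb x1 x2 x3 y1 y2 y3 u2 u3 : R) :
  bounds22 Cl Cu Vb x1 x2 x3 y1 y2 y3 u2 u3 ->
  ramps22 Cl Cu Vb (Cu - Cl) x1 x2 x3 y1 y2 y3 u2 u3.
Proof.
move=> [_ [_ [_ [_ [_ [_ [l1 [l2 [l3 [h1 [h2 h3]]]]]]]]]]].
split; first by move: h2 l1; clear; lra.
split; first by move: h3 l2; clear; lra.
split; first by move: h1 l2; clear; lra.
by split; [move: h2 l3|move: h1 l2 h3]; clear; lra.
Qed.

Lemma ramps11_of_bounds (R : realType) (Cl Cu Vb x1 x2 x3 y1 y2 y3 u2 u3 : R) :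
  bounds11 Cl Cu Vb x1 x2 x3 y1 y2 y3 u2 u3 ->
  ramps11 Cl Vb (Cu - Cl) x1 x2 x3 y1 y2 y3 u2 u3.
Proof.
move=> [_ [_ [_ [_ [l1 [l2 [l3 [_ [_ [_ [_ [h1 [h2 [h2' h3]]]]]]]]]]]]]].
split; first by move: h2' l1; clear; lra.
split; first by move: h2 l1; clear; lra.
split; first by move: h3 l2; clear; lra.
split; first by move: h1 l2; clear; lra.
by split; [move: h2'|move: h2]; move: l3; clear; lra.
Qed.

(** * Patterns available in the hull *)

Lemma commitment_bool (R : realType) (s1 s2 s3 : bool) :
  @commitment R s1%:R s2%:R s3%:R (~~ s1 && s2)%:R (~~ s2 && s3)%:R.
Proof.
have b (s : bool) : (s%:R = 0 :> R) \/ (s%:R = 1 :> R) by case: s; [right|left].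
rewrite /commitment; do 5!(split; first exact: b).
by case: s1 s2 s3 => -[] [] /=; split; lra.
Qed.

Lemma dispatch_le (R : realType) (Cl Cu Vb V V' t y1 y2 y3 x1 x2 x3 : R) :
  V <= V' -> 0 <= y1 -> 0 <= y2 -> 0 <= y3 ->
  dispatch Cl Cu Vb V t y1 y2 y3 x1 x2 x3 -> dispatch Cl Cu Vb V' t y1 y2 y3 x1 x2 x3.
Proof.
move=> VV y10 y20 y30 [box [[r1 r2] [r3 r4]]]; split=> //.
have le y : 0 <= y -> V * y <= V' * y by move=> ?; rewrite ler_wpM2r.
by split; split; [move: r1 (le _ y10)|move: r2 (le _ y20)|move: r3 (le _ y20)
  |move: r4 (le _ y30)]; clear; lra.
Qed.

Lemma dispatch_ge0 (R : realType) (Cl Cu Vb V t y1 y2 y3 x1 x2 x3 : R) :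
  0 <= Cl -> 0 <= y1 -> 0 <= y2 -> 0 <= y3 ->
  dispatch Cl Cu Vb V t y1 y2 y3 x1 x2 x3 -> 0 <= x1 /\ 0 <= x2 /\ 0 <= x3.
Proof.
move=> Cl0 y10 y20 y30 [[[b1 _] [[b2 _] [b3 _]]] _].
by do ?split; [apply: le_trans b1|apply: le_trans b2|apply: le_trans b3]; rewrite mulr_ge0.
Qed.

(** Minimum-up time 2 rules out 010, and minimum-down time 2 rules out 101. The limit [V'] of [P]
    may exceed the limit [V] of the dispatch, which only relaxes the ramps; case (B) relies on
    this. *)
Lemma available22 (R : realType) (Cl Cu Vb V V' t : R) (s1 s2 s3 : bool) :
  0 <= Cl -> V <= V' -> ~~ [&& ~~ s1, s2 & ~~ s3] -> ~~ [&& s1, ~~ s2 & s3] ->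
  available Cl Cu Vb V (conv_hull (P 3 2 2 Cl Cu Vb V')) s1 s2 s3 t.
Proof.
move=> Cl0 VV a010 a101; right=> z1 z2 z3 D; apply: sub_gen_smallest.
rewrite /mode !mul1r; apply/P22E; split; first exact: dispatch_ge0 D.
split; first exact: commitment_bool.
split; first exact: dispatch_le D.
by case: s1 s2 s3 a010 a101 {D} => -[] [] //= _ _; split; lra.
Qed.

Lemma available11 (R : realType) (Cl Cu Vb V V' t : R) (s1 s2 s3 : bool) :
  0 <= Cl -> V <= V' ->
  available Cl Cu Vb V (conv_hull (P 3 1 1 Cl Cu Vb V')) s1 s2 s3 t.
Proof.
move=> Cl0 VV; right=> z1 z2 z3 D; apply: sub_gen_smallest.
rewrite /mode !mul1r; apply/P11E; split; first exact: dispatch_ge0 D.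
split; first exact: commitment_bool.
split; first exact: dispatch_le D.
by case: s1 s2 s3 {D} => -[] [] /=; split; split; lra.
Qed.

Lemma hull_contains0 (R : realType) (Cl Cu Vb V : R) (K : set (schedule R 3)) :
  0 <= Vb -> available Cl Cu Vb V K false false false 1 -> K (pt 0 0 0 0 0 0 0 0).
Proof.
move=> Vb0 [/eqP|]; first by rewrite oner_eq0.
move=> /(_ 0 0 0); rewrite /mode /= !mulr0; apply.
by rewrite /dispatch !mulr0; do ?split; lra.
Qed.

(** * Weights of the patterns: listed points lie in the hull *)

Lemma cover22 (R : realType) (Cl Cu Vb V V' x1 x2 x3 y1 y2 y3 u2 u3 : R) :
  0 <= Cl -> Cl <= Vb -> Vb <= Cu -> 0 <= V -> Vb <= Cl + V -> Cl + V <= Cu ->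
  Cu <= Vb + V -> V <= V' ->
  bounds22 Cl Cu Vb x1 x2 x3 y1 y2 y3 u2 u3 ->
  ramps22 Cl Cu Vb V x1 x2 x3 y1 y2 y3 u2 u3 ->
  conv_hull (P 3 2 2 Cl Cu Vb V') (pt x1 x2 x3 y1 y2 y3 u2 u3).
Proof.
move=> Cl0 ClVb VbCu V0 VbV ClCu CuVb VV.
move=> [k1 [k2 [k3 [k4 [k5 [k6 [h1 [h2 [h3 [h4 [h5 h6]]]]]]]]]]].
move=> [h7 [h9 [h10 [h8 h11]]]].
have av := @available22 R Cl Cu Vb V V' _ _ _ _ Cl0 VV.
have K0 := hull_contains0 (le_trans Cl0 ClVb) (av 1 false false false isT isT).
(* A start in period 2 must lead to 011 and a start in period 3 to 001, so these weigh [u2] and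
   [u3]. The rest of [y3] is 111, then the rest of [y2] is 110 and the rest of [y1] is 100.
   Nonnegativity of these weights is exactly the six inequalities on y and u. *)
have := @modes_cover R Cl Cu Vb V (conv_hull (P 3 2 2 Cl Cu Vb V'))
  (1 - y1 - u2 - u3) (y1 + u2 - y2) 0 u3 (y2 - y3 + u3) u2 0 (y3 - u2 - u3) x1 x2 x3
  Cl0 ClVb VbCu V0 VbV ClCu CuVb (@conv_hull_convex _ _ _) K0
  (av _ false false false isT isT) (av _ true false false isT isT) (or_introl erefl)
  (av _ false false true isT isT) (av _ true true false isT isT)
  (av _ false true true isT isT) (or_introl erefl) (av _ true true true isT isT).
clear Cl0 ClVb VbCu V0 VbV ClCu CuVb VV av K0.
rewrite !add0r !addr0 !mulr0.
rewrite (_ : _ + (y2 - y3 + u3) + (y3 - u2 - u3) = y1); last by clear; ring.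
rewrite (_ : y2 - y3 + u3 + u2 + (y3 - u2 - u3) = y2); last by clear; ring.
rewrite (_ : u3 + u2 + (y3 - u2 - u3) = y3); last by clear; ring.
apply=> //; try by clear -k1 k2 k3 k4 k5 k6; lra.
- by move: h4; clear; lra.
- by move: h5; clear; lra.
- by move: h6; clear; lra.
- by move: h7; clear; lra.
- by move: h8; clear; lra.
- by move: h9; clear; lra.
- by move: h10; clear; lra.
- by move: h11; clear; lra.
Qed.

Lemma cover11 (R : realType) (Cl Cu Vb V V' x1 x2 x3 y1 y2 y3 u2 u3 : R) :
  0 <= Cl -> Cl <= Vb -> Vb <= Cu -> 0 <= V -> Vb <= Cl + V -> Cl + V <= Cu ->
  Cu <= Vb + V -> V <= V' ->
  bounds11 Cl Cu Vb x1 x2 x3 y1 y2 y3 u2 u3 ->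
  ramps11 Cl Vb V x1 x2 x3 y1 y2 y3 u2 u3 ->
  conv_hull (P 3 1 1 Cl Cu Vb V') (pt x1 x2 x3 y1 y2 y3 u2 u3).
Proof.
move=> Cl0 ClVb VbCu V0 VbV ClCu CuVb VV.
move=> [k1 [k2 [k3 [k4 [h1 [h2 [h3 [k5 [k6 [k7 [k8 [h4 [h5 [h5' h6]]]]]]]]]]]]]].
move=> [h7 [h7' [h9 [h10 [h8 h8']]]]].
have av := fun s1 s2 s3 t => @available11 R Cl Cu Vb V V' t s1 s2 s3 Cl0 VV.
have K0 := hull_contains0 (le_trans Cl0 ClVb) (av false false false 1).
(* Any value in this range will do: the four bounds say that the weights of 101, 000, 100 and 001
   are nonnegative. *)
have [|w13] := @exists_between R [:: 0; y1 + u2 + u3 - 1] [:: y1 - y2 + u2; u3].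
  by rewrite /= !andbT; repeat (apply/andP; split); clear -k1 k2 k3 k4 k5 k6 k7 k8; lra.
rewrite /= !andbT => -[/andP[l1 l2] /andP[l3 l4]].
have cov w2 w12 w23 w123 := @modes_cover R Cl Cu Vb V (conv_hull (P 3 1 1 Cl Cu Vb V'))
  (1 - y1 - u2 - u3 + w13) (y1 - y2 + u2 - w13) w2 (u3 - w13) w12 w23 w13 w123 x1 x2 x3
  Cl0 ClVb VbCu V0 VbV ClCu CuVb (@conv_hull_convex _ _ _) K0
  (av _ _ _ _) (av _ _ _ _) (av _ _ _ _) (av _ _ _ _)
  (av _ _ _ _) (av _ _ _ _) (av _ _ _ _) (av _ _ _ _).
clear Cl0 ClVb VbCu V0 VbV ClCu CuVb VV av K0.
(* The weight on in both periods 1 and 2 is [y2 - u2], and in both 2 and 3 it is [y3 - u3]; 111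
   receives the smaller of the two. Each case uses the matching one of the two inequalities on [x2],
   on [x2 - x1] and on [x2 - x3]. *)
have [yu|/ltW yu] := leP (y2 - u2) (y3 - u3).
  have := cov (y2 - y3 + u3) 0 (y3 - u3 - (y2 - u2)) (y2 - u2); clear cov.
  rewrite !add0r !addr0.
  rewrite (_ : y1 - y2 + u2 - w13 + w13 + (y2 - u2) = y1); last by clear; ring.
  rewrite (_ : y2 - y3 + u3 + (y3 - u3 - (y2 - u2)) + (y2 - u2) = y2); last by clear; ring.
  rewrite (_ : u3 - w13 + (y3 - u3 - (y2 - u2)) + w13 + (y2 - u2) = y3); last by clear; ring.
  rewrite (_ : y2 - y3 + u3 + (y3 - u3 - (y2 - u2)) = u2); last by clear; ring.
  rewrite (_ : u3 - w13 + w13 = u3); last by clear; ring.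
  apply=> //; try by clear -k1 k2 k3 k4 k5 k6 k7 k8 l1 l2 l3 l4 yu; lra.
  - by move: h4; clear; lra.
  - by move: h5; clear; lra.
  - by move: h6; clear; lra.
  - by move: h7'; clear; lra.
  - by move: h8'; clear; lra.
  - by move: h9; clear; lra.
  - by move: h10; clear; lra.
  (* No listed inequality bounds [x1 - x2 + x3]. Since 110 has weight 0 here, the bounds on
     [x3 - x2] and [x1] add up to the required one; in the other case 011 has weight 0 and the
     bounds on [x1 - x2] and [x3] do. *)
  - by move: h9 h4; clear; lra.
have := cov u2 (y2 - u2 - (y3 - u3)) 0 (y3 - u3); clear cov.
rewrite !add0r !addr0.
rewrite (_ : y1 - y2 + u2 - w13 + (y2 - u2 - (y3 - u3)) + w13 + (y3 - u3) = y1); last by clear; ring.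
rewrite (_ : u2 + (y2 - u2 - (y3 - u3)) + (y3 - u3) = y2); last by clear; ring.
rewrite (_ : u3 - w13 + w13 + (y3 - u3) = y3); last by clear; ring.
rewrite (_ : u3 - w13 + w13 = u3); last by clear; ring.
apply=> //; try by clear -k1 k2 k3 k4 k5 k6 k7 k8 l1 l2 l3 l4 yu; lra.
- by move: h4; clear; lra.
- by move: h5'; clear; lra.
- by move: h6; clear; lra.
- by move: h7; clear; lra.
- by move: h8; clear; lra.
- by move: h9; clear; lra.
- by move: h10; clear; lra.
- by move: h10 h6; clear; lra.
Qed.

(** * Convexity of the listed sets *)

Lemma entry_lin (R : realType) n (a b : R) (v w : 'rV[R]_n) k :
  entry (a *: v + b *: w) k = a * entry v k + b * entry w k.
Proof.
by rewrite /entry; case: insubP => [i _ _|_]; rewrite ?mxE// !mulr0 addr0.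
Qed.

Lemma convex_coords3 (R : realType) (S : R -> R -> R -> R -> R -> R -> R -> R -> Prop) :
  (forall a b, 0 <= a -> 0 <= b -> a + b = 1 ->
   forall x1 x2 x3 y1 y2 y3 u2 u3 x1' x2' x3' y1' y2' y3' u2' u3',
   S x1 x2 x3 y1 y2 y3 u2 u3 -> S x1' x2' x3' y1' y2' y3' u2' u3' ->
   S (a * x1 + b * x1') (a * x2 + b * x2') (a * x3 + b * x3')
     (a * y1 + b * y1') (a * y2 + b * y2') (a * y3 + b * y3')
     (a * u2 + b * u2') (a * u3 + b * u3')) ->
  convex_set (set_of_coords3 S).
Proof.
move=> cS p q t /set_mem Sp /set_mem Sq; apply/mem_set.
rewrite /set_of_coords3 /= /xc /yc /uc !entry_lin.
by apply: cS; rewrite ?subr_ge0 // addrC subrK.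
Qed.

Lemma combine_le (R : realType) (a b p q r s : R) : 0 <= a -> 0 <= b ->
  p <= q -> r <= s -> a * p + b * r <= a * q + b * s.
Proof. by move=> *; apply: lerD; apply: ler_wpM2l. Qed.

(** Linear inequalities pass to convex combinations one conjunct at a time; [ab1] serves those with
    a constant term, such as [y1 + u2 + u3 <= 1]. *)
Ltac combine_ineqs a0 b0 ab1 :=
  lazymatch goal with
  | |- (_ /\ _) -> (_ /\ _) -> (_ /\ _) =>
    let h := fresh in let h' := fresh in let H := fresh in let H' := fresh in
    move=> [h H] [h' H']; split;
    [ move: (combine_le a0 b0 h h') ab1; clear; lra
    | clear h h'; move: H H'; combine_ineqs a0 b0 ab1 ]
  | |- _ => let h := fresh in let h' := fresh in
    move=> h h'; move: (combine_le a0 b0 h h') ab1; clear; lra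
  end.

(** * Validity of the listed inequalities on [P] *)

(** Of the 32 zero-one vectors six survive. A start in 010 would violate [u2 + u3 <= y3], and the
    restart in 101 would violate [u2 + u3 <= 1 - y1]. *)
Lemma commitment22 (R : realType) (y1 y2 y3 u2 u3 : R) :
  commitment y1 y2 y3 u2 u3 -> u2 + u3 <= y3 -> u2 + u3 <= 1 - y1 ->
  exists s1 s2 s3 : bool,
  [/\ y1 = s1%:R, y2 = s2%:R, y3 = s3%:R,
   u2 = (~~ s1 && s2)%:R & u3 = (~~ s2 && s3)%:R] /\
   ~~ [&& ~~ s1, s2 & ~~ s3] && ~~ [&& s1, ~~ s2 & s3].
Proof.
move=> [] [->|->] [] [->|->] [] [->|->] [] [->|->] [] [->|->] [? ?] ? ?;
try (exfalso; lra).
- by exists false, false, false.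
- by exists false, false, true.
- by exists false, true, true.
- by exists true, false, false.
- by exists true, true, false.
- by exists true, true, true.
Qed.

Lemma commitment11 (R : realType) (y1 y2 y3 u2 u3 : R) :
  commitment y1 y2 y3 u2 u3 -> u2 <= y2 /\ u3 <= y3 -> u2 <= 1 - y1 /\ u3 <= 1 - y2 ->
  exists s1 s2 s3 : bool,
  [/\ y1 = s1%:R, y2 = s2%:R, y3 = s3%:R,
   u2 = (~~ s1 && s2)%:R & u3 = (~~ s2 && s3)%:R].
Proof.
move=> [] [->|->] [] [->|->] [] [->|->] [] [->|->] [] [->|->] [? ?] [? ?] [? ?];
try (exfalso; lra).
- by exists false, false, false.
- by exists false, false, true.
- by exists false, true, false.
- by exists false, true, true.
- by exists true, false, false.
- by exists true, false, true.
- by exists true, true, false.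
- by exists true, true, true.
Qed.

(** Checked pattern by pattern. Next to an off period, where the generation is 0, the ramp limit
    turns into the bound [Vb] on the generation itself. *)
Lemma P22_bounds (R : realType) (Cl Cu Vb V x1 x2 x3 y1 y2 y3 u2 u3 : R) :
  0 <= Cl -> Cl <= Vb -> Vb <= Cu ->
  P 3 2 2 Cl Cu Vb V (pt x1 x2 x3 y1 y2 y3 u2 u3) ->
  bounds22 Cl Cu Vb x1 x2 x3 y1 y2 y3 u2 u3.
Proof.
move=> Cl0 ClVb VbCu /P22E[[? [? ?]] [C [D [k1 k2]]]].
case: (commitment22 C k1 k2) D => s1 [s2 [s3 [[-> -> -> -> ->] a]]] {C k1 k2}.
by case: s1 s2 s3 a => -[] [] //= _ [[[? ?] [[? ?] [? ?]]] [[? ?] [? ?]]]; do ?split; lra.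
Qed.

Lemma P22_ramps (R : realType) (Cl Cu Vb V x1 x2 x3 y1 y2 y3 u2 u3 : R) :
  0 <= Cl -> Cl <= Vb -> Vb <= Cu -> 0 <= V -> Vb <= Cl + V -> Cl + V <= Cu ->
  P 3 2 2 Cl Cu Vb V (pt x1 x2 x3 y1 y2 y3 u2 u3) ->
  ramps22 Cl Cu Vb V x1 x2 x3 y1 y2 y3 u2 u3.
Proof.
move=> Cl0 ClVb VbCu V0 VbV ClCu /P22E[[? [? ?]] [C [D [k1 k2]]]].
case: (commitment22 C k1 k2) D => s1 [s2 [s3 [[-> -> -> -> ->] a]]] {C k1 k2}.
by case: s1 s2 s3 a => -[] [] //= _ [[[? ?] [[? ?] [? ?]]] [[? ?] [? ?]]]; do ?split; lra.
Qed.

Lemma P11_bounds (R : realType) (Cl Cu Vb V x1 x2 x3 y1 y2 y3 u2 u3 : R) :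
  0 <= Cl -> Cl <= Vb -> Vb <= Cu ->
  P 3 1 1 Cl Cu Vb V (pt x1 x2 x3 y1 y2 y3 u2 u3) ->
  bounds11 Cl Cu Vb x1 x2 x3 y1 y2 y3 u2 u3.
Proof.
move=> Cl0 ClVb VbCu /P11E[[? [? ?]] [C [D [k1 k2]]]].
case: (commitment11 C k1 k2) D => s1 [s2 [s3 [-> -> -> -> ->]]] {C k1 k2}.
by case: s1 s2 s3 => -[] [] /= [[[? ?] [[? ?] [? ?]]] [[? ?] [? ?]]]; do ?split; lra.
Qed.

Lemma P11_ramps (R : realType) (Cl Cu Vb V x1 x2 x3 y1 y2 y3 u2 u3 : R) :
  0 <= Cl -> Cl <= Vb -> Vb <= Cu -> 0 <= V -> Vb <= Cl + V -> Cl + V <= Cu ->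
  P 3 1 1 Cl Cu Vb V (pt x1 x2 x3 y1 y2 y3 u2 u3) ->
  ramps11 Cl Vb V x1 x2 x3 y1 y2 y3 u2 u3.
Proof.
move=> Cl0 ClVb VbCu V0 VbV ClCu /P11E[[? [? ?]] [C [D [k1 k2]]]].
case: (commitment11 C k1 k2) D => s1 [s2 [s3 [-> -> -> -> ->]]] {C k1 k2}.
by case: s1 s2 s3 => -[] [] /= [[[? ?] [[? ?] [? ?]]] [[? ?] [? ?]]]; do ?split; lra.
Qed.

(** * The two inclusions and the four cases *)

Lemma conv_hull_coords3 (R : realType) (A : set (schedule R 3))
    (S : R -> R -> R -> R -> R -> R -> R -> R -> Prop) :
  (forall a b, 0 <= a -> 0 <= b -> a + b = 1 ->
   forall x1 x2 x3 y1 y2 y3 u2 u3 x1' x2' x3' y1' y2' y3' u2' u3',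
   S x1 x2 x3 y1 y2 y3 u2 u3 -> S x1' x2' x3' y1' y2' y3' u2' u3' ->
   S (a * x1 + b * x1') (a * x2 + b * x2') (a * x3 + b * x3')
     (a * y1 + b * y1') (a * y2 + b * y2') (a * y3 + b * y3')
     (a * u2 + b * u2') (a * u3 + b * u3')) ->
  (forall x1 x2 x3 y1 y2 y3 u2 u3,
    A (pt x1 x2 x3 y1 y2 y3 u2 u3) -> S x1 x2 x3 y1 y2 y3 u2 u3) ->
  (forall x1 x2 x3 y1 y2 y3 u2 u3,
    S x1 x2 x3 y1 y2 y3 u2 u3 -> conv_hull A (pt x1 x2 x3 y1 y2 y3 u2 u3)) ->
  conv_hull A = set_of_coords3 S.
Proof.
move=> cS AS SA; apply/seteqP; split.
  apply: smallest_sub; first exact: convex_coords3.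
  by move=> p; rewrite [p in A p]pt_coords; exact: AS.
by move=> p Sp; rewrite [p]pt_coords; exact: SA.
Qed.

Theorem theorem6 (R : realType) (Cl Cu Vb V : R)
    (hCl : 0 <= Cl) (hClVb : Cl <= Vb) (hVbCu : Vb <= Cu) (hV : 0 < V) :
  (* (A) *)
  (Cl <= Vb -> Vb < Cl + V -> Cu - Cl - V >= 0 -> Cu - Vb - V < 0 ->
    (* (A1) *)
    conv_hull (P 3 2 2 Cl Cu Vb V) =
    set_of_coords3 (fun x1 x2 x3 y1 y2 y3 u2 u3 : R =>
      u2 + u3 <= y3 /\ y1 + u2 + u3 <= 1 /\
      u2 >= y2 - y1 /\ u3 >= y3 - y2 /\ u2 >= 0 /\ u3 >= 0 /\
      x1 >= Cl * y1 /\ x2 >= Cl * y2 /\ x3 >= Cl * y3 /\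
      x1 <= Vb * y1 + (Cu - Vb) * (y2 - u2) /\
      x2 <= Vb * y2 + (Cu - Vb) * (y3 - u3 - u2) /\
      x3 <= Cu * y3 - (Cu - Vb) * u3 /\
      x2 - x1 <= Vb * y2 - Cl * y1 + (Cl + V - Vb) * (y3 - u3 - u2) /\
      x3 - x2 <= (Cl + V) * y3 - Cl * y2 - (Cl + V - Vb) * u3 /\
      x1 - x2 <= Vb * y1 - (Vb - V) * y2 - (Cl + V - Vb) * u2 /\
      x2 - x3 <= Vb * y2 - Cl * y3 + (Cl + V - Vb) * (y3 - u3 - u2) /\
      x1 - x2 + x3 <= Vb * y1 - (Vb - V) * y2 + Vb * y3
                      + (Cu - Vb) * (y3 - u3 - u2))
    /\
    (* (A2) *)
    conv_hull (P 3 1 1 Cl Cu Vb V) =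
    set_of_coords3 (fun x1 x2 x3 y1 y2 y3 u2 u3 : R =>
      u2 >= y2 - y1 /\ u3 >= y3 - y2 /\ u2 >= 0 /\ u3 >= 0 /\
      x1 >= Cl * y1 /\ x2 >= Cl * y2 /\ x3 >= Cl * y3 /\
      u2 <= y2 /\ u3 <= y3 /\ y1 + u2 <= 1 /\ y2 + u3 <= 1 /\
      x1 <= Vb * y1 + (Cu - Vb) * (y2 - u2) /\
      x2 <= Cu * y2 - (Cu - Vb) * u2 /\
      x2 <= Vb * y2 + (Cu - Vb) * (y3 - u3) /\
      x3 <= Cu * y3 - (Cu - Vb) * u3 /\
      x2 - x1 <= Vb * y2 - Cl * y1 + (Cl + V - Vb) * (y3 - u3) /\
      x2 - x1 <= (Cl + V) * y2 - Cl * y1 - (Cl + V - Vb) * u2 /\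
      x3 - x2 <= (Cl + V) * y3 - Cl * y2 - (Cl + V - Vb) * u3 /\
      x1 - x2 <= Vb * y1 - (Vb - V) * y2 - (Cl + V - Vb) * u2 /\
      x2 - x3 <= Vb * y2 - (Vb - V) * y3 - (Cl + V - Vb) * u3 /\
      x2 - x3 <= (Cl + V) * y2 - Cl * y3 - (Cl + V - Vb) * u2))
  /\
  (* (B) *)
  (Cl <= Vb -> Vb < Cl + V -> Cu - Cl - V < 0 ->
    (* (B1) *)
    conv_hull (P 3 2 2 Cl Cu Vb V) =
    set_of_coords3 (fun x1 x2 x3 y1 y2 y3 u2 u3 : R =>
      u2 + u3 <= y3 /\ y1 + u2 + u3 <= 1 /\
      u2 >= y2 - y1 /\ u3 >= y3 - y2 /\ u2 >= 0 /\ u3 >= 0 /\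
      x1 >= Cl * y1 /\ x2 >= Cl * y2 /\ x3 >= Cl * y3 /\
      x1 <= Vb * y1 + (Cu - Vb) * (y2 - u2) /\
      x2 <= Vb * y2 + (Cu - Vb) * (y3 - u3 - u2) /\
      x3 <= Cu * y3 - (Cu - Vb) * u3)
    /\
    (* (B2) *)
    conv_hull (P 3 1 1 Cl Cu Vb V) =
    set_of_coords3 (fun x1 x2 x3 y1 y2 y3 u2 u3 : R =>
      u2 >= y2 - y1 /\ u3 >= y3 - y2 /\ u2 >= 0 /\ u3 >= 0 /\
      x1 >= Cl * y1 /\ x2 >= Cl * y2 /\ x3 >= Cl * y3 /\
      u2 <= y2 /\ u3 <= y3 /\ y1 + u2 <= 1 /\ y2 + u3 <= 1 /\
      x1 <= Vb * y1 + (Cu - Vb) * (y2 - u2) /\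
      x2 <= Cu * y2 - (Cu - Vb) * u2 /\
      x2 <= Vb * y2 + (Cu - Vb) * (y3 - u3) /\
      x3 <= Cu * y3 - (Cu - Vb) * u3)).
Proof.
split=> [_ VbV ClCu CuVb|_ VbV CuCl].
  have V0 := ltW hV; have VbV' := ltW VbV.
  have ClCu' : Cl + V <= Cu by move: ClCu; clear; lra.
  have CuVb' : Cu <= Vb + V by move: CuVb; clear; lra.
  split; apply: conv_hull_coords3.
  - move=> a b a0 b0 ab1; do 16!move=> ?.
    by combine_ineqs a0 b0 ab1.
  - move=> x1 x2 x3 y1 y2 y3 u2 u3 Px.
    have := P22_bounds hCl hClVb hVbCu Px.
    have := P22_ramps hCl hClVb hVbCu V0 VbV' ClCu' Px.
    by rewrite /bounds22 /ramps22; tauto.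
  - move=> x1 x2 x3 y1 y2 y3 u2 u3 S.
    by apply: (cover22 hCl hClVb hVbCu V0 VbV' ClCu' CuVb' (lexx V));
      move: S; rewrite /bounds22 /ramps22; tauto.
  - move=> a b a0 b0 ab1; do 16!move=> ?.
    by combine_ineqs a0 b0 ab1.
  - move=> x1 x2 x3 y1 y2 y3 u2 u3 Px.
    have := P11_bounds hCl hClVb hVbCu Px.
    have := P11_ramps hCl hClVb hVbCu V0 VbV' ClCu' Px.
    by rewrite /bounds11 /ramps11; tauto.
  - move=> x1 x2 x3 y1 y2 y3 u2 u3 S.
    by apply: (cover11 hCl hClVb hVbCu V0 VbV' ClCu' CuVb' (lexx V));
      move: S; rewrite /bounds11 /ramps11; tauto.
(* In case (B) [Cu - Cl] takes the place of the ramp limit in [cover22] and [cover11], while the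
   hull remains that of [P] with the larger limit [V]. *)
have W0 : 0 <= Cu - Cl by rewrite subr_ge0 (le_trans hClVb).
have VbW : Vb <= Cl + (Cu - Cl) by rewrite addrC subrK.
have ClW : Cl + (Cu - Cl) <= Cu by rewrite addrC subrK.
have CuW : Cu <= Vb + (Cu - Cl) by move: hClVb; clear; lra.
have WV : Cu - Cl <= V by move: CuCl; clear; lra.
split; apply: conv_hull_coords3.
- move=> a b a0 b0 ab1; do 16!move=> ?.
  by combine_ineqs a0 b0 ab1.
- by move=> *; apply: P22_bounds; eassumption.
- move=> x1 x2 x3 y1 y2 y3 u2 u3 S.
  exact: (cover22 hCl hClVb hVbCu W0 VbW ClW CuW WV S (ramps22_of_bounds S)).
- move=> a b a0 b0 ab1; do 16!move=> ?.
  by combine_ineqs a0 b0 ab1.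
- by move=> *; apply: P11_bounds; eassumption.
- move=> x1 x2 x3 y1 y2 y3 u2 u3 S.
  exact: (cover11 hCl hClVb hVbCu W0 VbW ClW CuW WV S (ramps11_of_bounds S)).
Qed.
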